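(* For every $c>0$, $\Lambda>0$ and $\omega>0$ there exists $R_\star>0$, depending only on $c$, $\omega$ and $\Lambda$, such that the following holds for every $\kappa>0$ and $\Theta\in\mathbb{R}$. If $R\in(0,R_\star)$ and the kernel $K$ satisfies $$K(r)\le\Lambda\,\chi_{(-R,R)}(r)\qquad\text{for all }r\in\mathbb{R},$$ then there exists a solution of $$\partial_t u(x,t)=c\,\partial_x^2u(x,t)+\int_{\mathbb{R}}\big(u(y,t)-\Theta\big)_+\,K(x-y)\,dy,\qquad x\in\mathbb{R},\ t\in\mathbb{R},$$ of the form $$u(x,t)=v(x+\omega t)+\Theta$$ for some $v:\mathbb{R}\to\mathbb{R}$ satisfying $v(0)=0$ and $v'(0)=\kappa$.
   Context: Here $r_+:=\max\{r,0\}$, $\chi_A$ is the characteristic function of the set $A$, and $K:\mathbb{R}\to[0,+\infty)$ is a nonnegative measurable function. Solutions are classical: $u$ is continuously differentiable in $t$ and twice continuously differentiable in $x$, so that $v\in C^2(\mathbb{R})$, the integral is finite, and the equation holds pointwise. *)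

(* Defs.v *)
From HB Require Import structures.
From mathcomp Require Import all_boot all_order all_algebra.
From mathcomp Require Import all_classical all_reals all_analysis.
Import Order.TTheory GRing.Theory Num.Theory.
Import numFieldNormedType.Exports.

Set Implicit Arguments.
Unset Strict Implicit.
Unset Printing Implicit Defensive.

Local Open Scope ring_scope.
Local Open Scope classical_set_scope.

(* The carrier is R, equipped with the sigma-algebra of Lebesgue measurable
   sets (the domain of completed_lebesgue_measure) instead of the Borel one. *)
Notation lebesgueTypeR R :=
  (caratheodory_type (mu_ext (wlength (R := R) idfun))).

Definition lebesgue_measurable_fun (R : realType) (K : R -> R) : Prop :=
  measurable_fun [set: lebesgueTypeR R] (K : lebesgueTypeR R -> R).

Definition pos_part (R : realType) (s : R) : R := Num.max s 0.

Definition C2 (R : realType) (v : R -> R) : Prop :=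
  [/\ forall s, derivable v s 1,
      forall s, derivable (derive1 v) s 1
    & continuous (derive1n 2 v) ].

(* Time and space derivatives of u, where u x t is u(x,t). *)
Definition dt (R : realType) (u : R -> R -> R) (x t : R) : R :=
  derive1 (u x) t.

Definition dx (R : realType) (u : R -> R -> R) (x t : R) : R :=
  derive1 (u^~ t) x.

Definition dxx (R : realType) (u : R -> R -> R) (x t : R) : R :=
  derive1n 2 (u^~ t) x.

(* C^1 in t and C^2 in x. All continuity is joint in (x,t). *)
Definition C21 (R : realType) (u : R -> R -> R) : Prop :=
  [/\ forall x t, derivable (u x) t 1,
      forall x t, derivable (u^~ t) x 1,
      forall x t, derivable (derive1 (u^~ t)) x 1
    & [/\ continuous (fun p : R * R => u p.1 p.2),
          continuous (fun p : R * R => dt u p.1 p.2),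
          continuous (fun p : R * R => dx u p.1 p.2)
        & continuous (fun p : R * R => dxx u p.1 p.2)]].

Definition interaction (R : realType) (K : R -> R) (Theta : R)
    (u : R -> R -> R) (x t : R) (y : lebesgueTypeR R) : R :=
  pos_part (u y t - Theta) * K (x - (y : R)).

Definition classical_solution (R : realType) (c Theta : R) (K : R -> R)
    (u : R -> R -> R) : Prop :=
  [/\ C21 u,
      forall x t, (@completed_lebesgue_measure R).-integrable setT
        (EFin \o interaction K Theta u x t)
    & forall x t, dt u x t = c * dxx u x t +
        \int[@completed_lebesgue_measure R]_y interaction K Theta u x t y].

(* Main.v *)
Require Import Defs.
From HB Require Import structures.
From mathcomp Require Import all_boot all_order all_algebra.
From mathcomp Require Import all_classical all_reals all_analysis.
From mathcomp Require Import measurable_realfun ring lra.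
Import Order.TTheory GRing.Theory Num.Theory.
Import numFieldNormedType.Exports.

Set Implicit Arguments.
Unset Strict Implicit.
Unset Printing Implicit Defensive.

Local Open Scope ring_scope.
Local Open Scope classical_set_scope.

(** The profile v has to solve v'' = (omega / c) v' - (1 / c) N(v) with v(0) = 0
and v'(0) = kappa, where N(v)(s) is the integral of v_+(y) K(s - y) over y. For
a bounded kernel of short range, N is a small Lipschitz operator, so that this
is a small nonlocal perturbation of a linear second-order initial value problem
on the whole line, and Picard iteration solves it, whatever the sign of v: the
positive part enters as a 1-Lipschitz function that vanishes at 0.

Put l = omega / c and measure functions by the weight e^{(l+1)|s|}. Solving the
linear problem with right-hand side m and zero data does not increase the
weighted norm ([second_order_growth_abs]): the rate l + 1 exceeds by 1 the
growth rate l of the homogeneous equation, and by at least 1 the rate 0. On the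
other side, N looks at v only on ]s - r, s + r[, which costs a factor
2 r Lambda e^{(l+1) r} ([conv_dist_le]). For r < 1 and
r < c / (4 Lambda e^{l+1}) the composition halves the weighted norm, and the
iterates converge locally uniformly to a fixed point ([picard_fixpoint]). These
two bounds on r define the radius.

The kernel is only Lebesgue measurable, and N(v) has to be continuous for the
solution to be classical. Both points are settled by the substitution z = x - y,
which leaves K fixed and lets the variable x enter through the continuous factor
v_+(x - z) alone; dominated convergence then gives continuity. The substitution
is carried out after replacing K by a Borel function equal to it outside a Borel
null set ([borel_version], [completed_integral_reflect]). *)

(** * Differential inequalities *)

Lemma is_derive_continuous (R : realType) (F f : R -> R) :
  (forall s, is_derive s (1:R) F (f s)) -> continuous F.
Proof.
move=> dF s; apply: differentiable_continuous; apply/derivable1_diffP.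
by case: (dF s).
Qed.

Lemma is_derive_expRM (R : realType) (a s : R) :
  is_derive s (1:R) (fun x => expR (a * x)) (a * expR (a * s)).
Proof.
have H : is_derive s (1:R) (fun x : R => a * x) a.
  by have := is_deriveZ a (is_derive_id s (1:R)); rewrite /GRing.scale/= mulr1.
have := @is_derive1_comp R expR (fun x => a * x) s _ _ (is_derive_expR _) H.
by rewrite mulrC.
Qed.

Lemma continuous_expRM (R : realType) (a : R) : continuous (fun x => expR (a * x)).
Proof. exact: (is_derive_continuous (is_derive_expRM a)). Qed.

Lemma is_derive_reflect (R : realType) (F f : R -> R) :
  (forall s, is_derive s (1:R) F (f s)) ->
  forall s, is_derive s (1:R) (fun x => F (- x)) (- f (- s)).
Proof.
move=> dF s.
have := @is_derive1_comp R F -%R s _ _ (dF _) (is_deriveNid _ _).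
by rewrite mulrN1.
Qed.

Lemma derive_le (R : realType) (F G f g : R -> R) :
  (forall s, is_derive s (1:R) F (f s)) ->
  (forall s, is_derive s (1:R) G (g s)) ->
  F 0 <= G 0 -> (forall s, 0 <= s -> f s <= g s) ->
  forall s, 0 <= s -> F s <= G s.
Proof.
move=> dF dG FG0 fg s s0.
have dGF x : is_derive x (1:R) (G - F) (g x - f x) by exact: is_deriveB.
have [|] := @MVT_segment R (G - F) (fun x => g x - f x) 0 s s0 (fun x _ => dGF x).
  by apply: continuous_subspaceT; exact: is_derive_continuous dGF.
move=> x; rewrite in_itv/= => /andP[x0 _].
rewrite -![(G - F) _]/(G _ - F _) subr0 => E.
have : 0 <= (g x - f x) * s by rewrite mulr_ge0// subr_ge0 fg.
by rewrite -E; lra.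
Qed.

(** For a rate a >= 1 the function A e^{as} is dominated by its own derivative,
so integrating a bound of this form reproduces it with the same constant. *)
Lemma exp_growth (R : realType) (F f : R -> R) (A a : R) :
  (forall s, is_derive s (1:R) F (f s)) ->
  1 <= a -> `|F 0| <= A -> (forall s, 0 <= s -> `|f s| <= A * expR (a * s)) ->
  forall s, 0 <= s -> `|F s| <= A * expR (a * s).
Proof.
move=> dF a1 F0 fA s s0.
have A0 : 0 <= A by exact: le_trans F0.
have dG x : is_derive x (1:R) (fun x => A * expR (a * x)) (A * (a * expR (a * x))).
  exact: (is_deriveZ A (is_derive_expRM a x)).
have fA' x : 0 <= x -> `|f x| <= A * (a * expR (a * x)).
  move=> x0; apply: (le_trans (fA _ x0)).
  by rewrite ler_wpM2l// ler_peMl// expR_ge0.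
move: F0; rewrite !ler_norml => /andP[F0l F0r]; apply/andP; split; last first.
  apply: (derive_le dF dG) => //.
    by rewrite mulr0 expR0 mulr1.
  by move=> x /fA'; rewrite ler_norml => /andP[].
rewrite lerNl.
have dN x : is_derive x (1:R) (- F) (- f x) by exact: is_deriveN.
apply: (derive_le dN dG) => //.
  by rewrite mulr0 expR0 mulr1 -[(- F) 0]/(- F 0) lerNl.
by move=> x /fA'; rewrite ler_norml => /andP[]; rewrite lerNl.
Qed.

(** The integrating factor e^{-ls} turns the equation for w into z' = e^{-ls} m,
where the right-hand side has rate mu - l >= 1; [exp_growth] applies to z and
then, since mu >= 1, to D. *)
Lemma second_order_growth (R : realType) (D w m : R -> R) (l mu A : R) :
  (forall s, is_derive s (1:R) D (w s)) ->
  (forall s, is_derive s (1:R) w (l * w s + m s)) ->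
  l + 1 <= mu -> 1 <= mu -> `|D 0| <= A -> `|w 0| <= A ->
  (forall s, 0 <= s -> `|m s| <= A * expR (mu * s)) ->
  forall s, 0 <= s -> `|D s| <= A * expR (mu * s).
Proof.
move=> dD dw lmu mu1 D0 w0 mA; apply: (exp_growth dD) => // s s0.
have dz x : is_derive x (1:R) ((fun x => expR (- l * x)) * w) (expR (- l * x) * m x).
  apply: (is_derive_eq (is_deriveM (is_derive_expRM (- l) x) (dw x))).
  by rewrite /GRing.scale/=; ring.
have := exp_growth (A := A) (a := mu - l) dz _ _ _ s0.
rewrite -[(_ * w) s]/(_ * w s) -[(_ * w) 0]/(_ * w 0).
rewrite mulr0 expR0 mul1r normrM (gtr0_norm (expR_gt0 _)) => H.
have {}H : expR (- l * s) * `|w s| <= A * expR ((mu - l) * s).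
  apply: H => //; first by lra.
  move=> x x0; rewrite normrM (gtr0_norm (expR_gt0 _)).
  rewrite mulrDl expRD mulrA [leLHS]mulrC ler_wpM2r ?expR_ge0//.
  exact: mA.
by move: H; rewrite mulrDl expRD mulrA [leLHS]mulrC ler_pM2r ?expR_gt0.
Qed.

(** On the negative half-line, reflection replaces l by - l, for which the rate
l + 1 is still large enough. *)
Lemma second_order_growth_abs (R : realType) (D w m : R -> R) (l A : R) :
  (forall s, is_derive s (1:R) D (w s)) ->
  (forall s, is_derive s (1:R) w (l * w s + m s)) ->
  0 <= l -> `|D 0| <= A -> `|w 0| <= A ->
  (forall s, `|m s| <= A * expR ((l + 1) * `|s|)) ->
  forall s, `|D s| <= A * expR ((l + 1) * `|s|).
Proof.
move=> dD dw l0 D0 w0 mA s.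
have [s0|s0] := leP 0 s.
  rewrite (ger0_norm s0); apply: (second_order_growth dD dw) => //; try lra.
  by move=> x x0; have := mA x; rewrite (ger0_norm x0).
have dD' := is_derive_reflect dD.
have dw' x : is_derive x (1:R) (fun x => - w (- x)) (- l * (- w (- x)) + m (- x)).
  by apply: (is_derive_eq (is_deriveN (is_derive_reflect dw x))); ring.
rewrite (ltr0_norm s0) -{1}(opprK s).
apply: (second_order_growth dD' dw') => //.
all: rewrite ?oppr0 ?normrN //; try lra.
move=> x x0; have := mA (- x); by rewrite normrN (ger0_norm x0).
Qed.

(** * Limits of geometrically convergent sequences *)

(** The intervals centred at u n of radius 2 C 2^-n are nested, so the supremum
of their left ends lies in all of them. *)
Lemma geometric_cauchy_limit (R : realType) (u : nat -> R) (C : R) :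
  (forall n, `|u n.+1 - u n| <= C * 2^-1 ^+ n) ->
  exists l, forall n, `|l - u n| <= 2 * C * 2^-1 ^+ n.
Proof.
move=> uC.
pose a n : R := 2 * C * 2^-1 ^+ n.
have aS n : a n.+1 = a n - C * 2^-1 ^+ n by rewrite /a exprS; field.
have lo m n : (m <= n)%N -> u m - a m <= u n - a n.
  move=> /subnKC <-; elim: (n - m)%N => [|k IH]; first by rewrite addn0.
  apply: (le_trans IH); rewrite addnS aS.
  by have := uC (m + k)%N; rewrite ler_norml => /andP[]; lra.
have hi m n : (m <= n)%N -> u n + a n <= u m + a m.
  move=> /subnKC <-; elim: (n - m)%N => [|k IH]; first by rewrite addn0.
  apply: (le_trans _ IH); rewrite addnS aS.
  by have := uC (m + k)%N; rewrite ler_norml => /andP[]; lra.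
have a0 n : 0 <= a n.
  have C0 : 0 <= C by have := uC 0%N; rewrite expr0 mulr1; exact: le_trans.
  by rewrite /a mulr_ge0 ?exprn_ge0 ?mulr_ge0 ?invr_ge0//.
have lohi m n : u m - a m <= u n + a n.
  have [mn|nm] := leqP m n.
    by have := lo _ _ mn; have := a0 n; lra.
  by have := hi _ _ (ltnW nm); have := a0 m; lra.
pose E := [set u n - a n | n in [set: nat]].
have E0 : E !=set0 by exists (u 0%N - a 0%N), 0%N.
have Eu m : ubound E (u m + a m) by move=> _ [n _ <-]; exact: lohi.
exists (sup E) => n; rewrite ler_norml; apply/andP; split.
  suff : u n - a n <= sup E by rewrite /a; lra.
  by apply: ub_le_sup; [exists (u 0%N + a 0%N); exact: Eu|exists n].
suff : sup E <= u n + a n by rewrite /a; lra.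
exact: ge_sup.
Qed.

Lemma le0_geometric (R : realType) (x C : R) :
  (forall n, x <= C * 2^-1 ^+ n) -> x <= 0.
Proof.
move=> H.
have cv : (fun n => C * 2^-1 ^+ n) @ \oo --> (C * 0 : R).
  apply: cvgM; first exact: cvg_cst.
  by apply: cvg_expr; rewrite ger0_norm ?invr_ge0// invf_lt1// ltr1n.
rewrite -(mulr0 C) -(cvg_lim _ cv)//.
apply: limr_ge; first by apply/cvg_ex; exists (C * 0).
by apply: nearW.
Qed.

(** The weight e^{a|x|} is bounded for |x| <= |s| + 1, so the convergence is
uniform near s. *)
Lemma continuous_geometric_limit (R : realType) (v : R -> R) (vn : nat -> R -> R)
    (C a : R) : 0 <= C -> 0 <= a ->
  (forall n, continuous (vn n)) ->
  (forall n s, `|v s - vn n s| <= C * expR (a * `|s|) * 2^-1 ^+ n) ->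
  continuous v.
Proof.
move=> C0 a0 cvn vC s; apply/cvgrPdist_le => e e0.
pose B := C * expR (a * (`|s| + 1)).
have B0 : 0 <= B by rewrite mulr_ge0// expR_ge0.
have [n Bn] : exists n, B * 2^-1 ^+ n <= e / 3.
  apply: contrapT => /forallNP H.
  suff : e / 3 <= 0 by lra.
  apply: (@le0_geometric _ _ B) => n; apply: ltW; rewrite ltNge; apply/negP.
  exact: H.
(* n is such that v and vn n differ by at most e / 3 near s. *)
have le_B x : `|x| <= `|s| + 1 -> `|v x - vn n x| <= e / 3.
  move=> xs; apply: (le_trans (vC n x)); apply: le_trans Bn.
  rewrite ler_wpM2r ?exprn_ge0 ?invr_ge0// ler_wpM2l// ler_expR ler_wpM2l//.
have /cvgrPdist_le/(_ (e / 3)) := cvn n s.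
have e3 : 0 < e / 3 by lra.
move=> /(_ e3) H; near=> y.
have h1 : `|vn n s - vn n y| <= e / 3 by near: y.
have h2 : `|y| <= `|s| + 1.
  have : `|s - y| <= 1 by near: y; apply: cvgr_dist_le; [exact: cvg_id|].
  by have := ler_normB s (s - y); rewrite opprB addrC subrK; lra.
have h3 : `|v s - vn n s| <= e / 3 by apply: le_B; lra.
have h4 := le_B _ h2.
have -> : v s - v y = (v s - vn n s) + (vn n s - vn n y) - (v y - vn n y) by ring.
apply: (le_trans (ler_normB _ _)).
by have := ler_normD (v s - vn n s) (vn n s - vn n y); lra.
Unshelve. all: by end_near. Qed.

(** * The nonlocal initial value problem *)

(** The fundamental theorem of calculus gives the derivative of an integral with
fixed left end a at points to the right of a. The difference of the integrals over
[a, s] and [a, 0] does not depend on a as long as a <= s and a <= 0, so the left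
end may move with s. *)
Lemma primitive_exists (R : realType) (f : R -> R) : continuous f ->
  exists F : R -> R, F 0 = 0 /\ forall s, is_derive s (1:R) F (f s).
Proof.
move=> cf.
pose mu := @lebesgue_measure R.
have fi a b : mu.-integrable `[a, b] (EFin \o f).
  apply: continuous_compact_integrable; first exact: segment_compact.
  exact: continuous_subspaceT.
pose G a s := (\int[mu]_(t in `[a, s]) f t - \int[mu]_(t in `[a, 0]) f t)%R.
have GE a b s : a <= b -> b <= s -> b <= 0 -> G a s = G b s.
  move=> ab bs b0.
  pose I x := (\int[mu]_(t in `]b, x]) f t)%R.
  have IE c x : c <= b -> b <= x ->
      (\int[mu]_(t in `[c, x]) f t - \int[mu]_(t in `[c, b]) f t = I x)%R.
    by move=> cb bx; apply: Rintegral_itvB => //; rewrite bnd_simp.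
  have E c : c <= b -> G c s = I s - I 0.
    by move=> cb; rewrite -(IE c s)// -(IE c 0)// /G; ring.
  by rewrite !E.
exists (fun s => G (- (`|s| + 1)) s); split; first by rewrite /G subrr.
move=> s.
(* Near s the moving left end - (`|x| + 1) stays to the right of this fixed one. *)
pose a : R := - (`|s| + 2).
have dG : is_derive s (1:R) (G a) (f s).
  have ls : a < s by have := ler_norm (- s); rewrite normrN /a; lra.
  have [|d1 d2] := @continuous_FTC1_closed R f a s (s + 1) _ (fi _ _) ls (cf s).
    by rewrite ltrDl.
  rewrite derive1E in d2.
  apply: (is_derive_eq (is_deriveB (DeriveDef d1 d2)
    (is_derive_cst (\int[mu]_(t in `[a, 0%R]) f t)%R s 1))).
  by rewrite subr0.
apply: (near_eq_is_derive _ dG).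
near=> x.
have xs : `|s - x| <= 1 by near: x; apply: cvgr_dist_le; [exact: cvg_id|].
apply: GE.
- by have := ler_normB s (s - x); rewrite opprB addrC subrK /a; lra.
- by have := ler_norm (- x); rewrite normrN; lra.
- by have := normr_ge0 x; lra.
Unshelve. all: by end_near. Qed.

(** Duhamel's formula: w(s) = e^{ls} (k + the primitive of e^{-ls} g). *)
Lemma linear_ode_solvable (R : realType) (l k : R) (g : R -> R) : continuous g ->
  exists v w : R -> R, [/\ v 0 = 0, w 0 = k,
    forall s, is_derive s (1:R) v (w s) &
    forall s, is_derive s (1:R) w (l * w s + g s)].
Proof.
move=> cg.
have cf : continuous (fun s => expR (- l * s) * g s).
  by move=> s; apply: cvgM; [exact: continuous_expRM|exact: cg].
have [F [F0 dF]] := primitive_exists cf.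
pose w := (fun s => expR (l * s)) * (F + cst k).
have dw s : is_derive s (1:R) w (l * w s + g s).
  apply: (is_derive_eq (is_deriveM (is_derive_expRM l s)
    (is_deriveD (dF s) (is_derive_cst k s 1)))).
  have -> : w s = expR (l * s) * (F s + k) by [].
  have -> : (F + cst k) s = F s + k by [].
  have E : expR (l * s) * expR (- l * s) = 1 by rewrite mulNr expRxMexpNx_1.
  by rewrite /GRing.scale/= -[in RHS](mul1r (g s)) -E; ring.
have [v [v0 dv]] := primitive_exists (is_derive_continuous dw).
exists v, w; split => //.
by rewrite /w -[LHS]/(expR (l * 0) * (F 0 + k)) mulr0 expR0 F0; ring.
Qed.

(** The factor 1/2 is the contraction constant in the weighted norm, because
solving the linear problem costs nothing. The hypothesis on N 0 makes the first
iterate a solution of the homogeneous equation, which has finite norm. *)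
Lemma picard_fixpoint (R : realType) (N : (R -> R) -> R -> R) (l k : R) :
  0 <= l ->
  (forall v : R -> R, continuous v -> continuous (N v)) ->
  N (fun=> 0) = (fun=> 0) ->
  (forall (v1 v2 : R -> R) (A : R), continuous v1 -> continuous v2 -> 0 <= A ->
    (forall s, `|v1 s - v2 s| <= A * expR ((l + 1) * `|s|)) ->
    forall s, `|N v1 s - N v2 s| <= A / 2 * expR ((l + 1) * `|s|)) ->
  exists v w : R -> R, [/\ v 0 = 0, w 0 = k,
    forall s, is_derive s (1:R) v (w s) &
    forall s, is_derive s (1:R) w (l * w s + N v s)].
Proof.
move=> l0 Nc N0 NL.
pose sol (u : R -> R) (p : (R -> R) * (R -> R)) := [/\ p.1 0 = 0, p.2 0 = k,
    forall s, is_derive s (1:R) p.1 (p.2 s) &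
    forall s, is_derive s (1:R) p.2 (l * p.2 s + N u s)].
have [T HT] : {T & forall u : R -> R, continuous u -> sol u (T u)}.
  apply: (@choice _ _ (fun u p => continuous u -> sol u p)) => u.
  (* For discontinuous u there is nothing to solve; any value will do. *)
  have [cu|ncu] := pselect (continuous u); last by exists (u, u).
  by have [v [w ?]] := linear_ode_solvable l k (Nc u cu); exists (v, w).
have cT (u : R -> R) : continuous u -> continuous (T u).1.
  by move=> /HT[_ _ d _]; exact: is_derive_continuous d.
have contr (u1 u2 : R -> R) (A : R) : continuous u1 -> continuous u2 -> 0 <= A ->
    (forall s, `|u1 s - u2 s| <= A * expR ((l + 1) * `|s|)) ->
    forall s, `|(T u1).1 s - (T u2).1 s| <= A / 2 * expR ((l + 1) * `|s|).
  move=> c1 c2 A0 uA.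
  have [a1 b1 d1 e1] := HT _ c1; have [a2 b2 d2 e2] := HT _ c2.
  apply: (@second_order_growth_abs _ ((T u1).1 - (T u2).1)
    (fun s => (T u1).2 s - (T u2).2 s) (fun s => N u1 s - N u2 s)) => //.
  - move=> s; apply: (is_derive_eq (is_deriveB (e1 s) (e2 s))); ring.
  - by rewrite -[(_ - _) 0]/((T u1).1 0 - (T u2).1 0) a1 a2 subrr normr0; lra.
  - by rewrite b1 b2 subrr normr0; lra.
  - exact: NL.
pose vn n : R -> R := iter n (fun u : R -> R => (T u).1) (fun=> 0 : R).
have cvn n : continuous (vn n).
  elim: n => [|n IH]; first by move=> s; exact: cvg_cst.
  exact: cT.
pose C (s : R) : R := `|k| * expR ((l + 1) * `|s|).
have step n s : `|vn n.+1 s - vn n s| <= C s * 2^-1 ^+ n.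
  rewrite /C mulrAC; elim: n s => [s|n IH s].
    rewrite expr0 mulr1 subr0.
    have [a b d e] := HT _ (cvn 0%N).
    apply: (second_order_growth_abs d e) => // [||x].
    - by rewrite a normr0.
    - by rewrite b.
    - by rewrite N0 normr0; apply: mulr_ge0 => //; exact: expR_ge0.
  rewrite exprSr mulrA.
  exact: (contr (vn n.+1) (vn n)).
have /choice[v vC] s : exists x, forall n, `|x - vn n s| <= 2 * C s * 2^-1 ^+ n.
  exact: (geometric_cauchy_limit (fun n => step n s)).
have vC' n s : `|v s - vn n s| <= 2 * `|k| * expR ((l + 1) * `|s|) * 2^-1 ^+ n.
  by rewrite -(mulrA 2); exact: vC.
have cv : continuous v.
  by apply: (continuous_geometric_limit _ _ cvn vC'); rewrite ?mulr_ge0//; lra.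
(* Both v and T v are within a multiple of 2^-n of the iterate n + 1. *)
suff vT : (T v).1 = v.
  have [a b d e] := HT _ cv.
  by exists v, (T v).2; split => //; rewrite -{1}vT.
apply/funext => s; apply/eqP; rewrite -subr_eq0 -normr_le0.
apply: (@le0_geometric _ _ (2 * C s)) => n.
have h1 := vC s n.+1.
have h2 : `|(T v).1 s - vn n.+1 s| <=
    2 * `|k| * 2^-1 ^+ n / 2 * expR ((l + 1) * `|s|).
  apply: contr => // x.
  by rewrite mulrAC; exact: vC'.
have -> : (T v).1 s - v s = ((T v).1 s - vn n.+1 s) - (v s - vn n.+1 s) by ring.
apply: (le_trans (ler_normB _ _)); apply: (le_trans (lerD h2 h1)).
by rewrite /C exprS; rewrite le_eqVlt; apply/orP; left; apply/eqP; field.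
Qed.

(** * Lebesgue measurable kernels *)

(** A Lebesgue measurable set is a Borel set up to a subset of a Borel null set.
Apply this to the sets where K exceeds a given rational, and set K to 0 on the
union of the countably many null sets. *)
Lemma borel_version (R : realType) (K : R -> R) :
  lebesgue_measurable_fun K -> (forall s, 0 <= K s) ->
  exists (K' : R -> R) (Z : set (measurableTypeR R)),
    [/\ measurable_fun [set: measurableTypeR R] K',
        measurable Z, @lebesgue_measure R Z = 0%E,
        forall s, ~ Z s -> K' s = K s &
        forall s, 0 <= K' s <= K s].
Proof.
move=> mK K0.
(* The rationals are indexed by nat because countable unions of negligible sets
   are. *)
pose r n : R := ratr (odflt 0 (unpickle n : option rat)).
have key n : exists A Z : set (measurableTypeR R),
    [/\ measurable A, measurable Z, @lebesgue_measure R Z = 0%E &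
        forall s, ~ Z s -> A s <-> r n < K s].
  have : (completed_algebra_gen (@lebesgue_measure R)) (K @^-1` `]r n, +oo[).
    rewrite -g_sigma_completed_algebra_genE completed_caratheodory_measurable.
    rewrite -[X in _.-measurable X]setTI.
    by apply: mK => //; exact: measurable_itv.
  move=> [A mA [N [Z [mZ Z0 NZ]]] AN].
  exists A, Z; split => // s nZs.
  have -> : (r n < K s : Prop) = (K @^-1` `]r n, +oo[) s.
    by rewrite /= in_itv/= andbT.
  by rewrite -AN; split => [|[//|/NZ//]]; left.
have [A /choice[Z AZ]] := choice key.
pose ZZ : set (measurableTypeR R) := \bigcup_n Z n.
have mZZ : measurable ZZ by apply: bigcupT_measurable => n; case: (AZ n).
have K'E s : (K \_ (~` ZZ)) s = if s \in ZZ then 0 else K s.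
  by rewrite patchE in_setC; case: (s \in ZZ).
exists (K \_ (~` ZZ)), ZZ; split => //.
- apply: (measurability _ (RGenOInfty.measurableE R)) => _ [_ [x ->] <-].
  (* The sets A n describe K off ZZ only; on ZZ, K' = 0 exceeds just the levels
     x < 0, which are treated apart. *)
  rewrite setTI; have [x0|x0] := ltP x 0.
    rewrite [X in measurable X](_ : _ = setT); first exact: measurableT.
    apply/seteqP; split => // s _ /=.
    by rewrite in_itv/= andbT K'E; case: ifPn => // _; exact: lt_le_trans (K0 s).
  rewrite [X in measurable X](_ : _ =
      (\bigcup_n (if x < r n then A n else set0)) `\` ZZ); last first.
    apply/seteqP; split => s /=; rewrite in_itv/= andbT K'E.
      case: ifPn => [_|]; first by rewrite ltNge x0.
      rewrite notin_setE => nZ xK; split => //.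
      have [q] := rat_in_itvoo xK; rewrite in_itv/= => /andP[xq qK].
      have rq : r (pickle q) = ratr q by rewrite /r pickleK.
      exists (pickle q) => //; rewrite rq xq.
      have [_ _ _ AK] := AZ (pickle q); apply/AK; last by rewrite rq.
      by move=> Zs; apply: nZ; exists (pickle q).
    move=> [[n _]]; case: ifPn => // xr An nZ.
    rewrite ifF; last by apply/negbTE; rewrite notin_setE.
    apply: (lt_trans xr); have [_ _ _ AK] := AZ n; apply/AK => // Zs.
    by apply: nZ; exists n.
  apply: measurableD => //; apply: bigcupT_measurable => n.
  by case: ifPn => _; [case: (AZ n)|exact: measurable0].
- apply: measure_negligible => //; apply: negligible_bigcup => n.
  by have [_ mZ Z0 _] := AZ n; exists (Z n); split.
- by move=> s nZ; rewrite K'E ifF//; apply/negbTE; rewrite notin_setE.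
- move=> s; rewrite K'E; case: ifPn => _; first by rewrite lexx K0.
  by rewrite lexx K0.
Qed.

Lemma measurable_reflect (R : realType) (x : R) :
  measurable_fun [set: lebesgueTypeR R] ((fun y => x - y) : _ -> measurableTypeR R).
Proof.
move=> _ A mA; rewrite setTI; apply: sub_caratheodory.
rewrite -[X in measurable X]setTI.
suff : measurable_fun [set: measurableTypeR R] (fun y : R => x - y) by exact.
exact: measurable_funB.
Qed.

(** Both sides are measures on the Borel sets that agree on the intervals
]a, b], whose reflections are [x - b, x - a[. *)
Lemma completed_reflect (R : realType) (x : R) (A : set (measurableTypeR R)) :
  measurable A ->
  @completed_lebesgue_measure R ((fun y => x - y) @^-1` A) = lebesgue_measure A.
Proof.
move=> mA.
apply/esym.
have mphi := measurable_reflect x.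
apply: (@lebesgue_measure_unique R (pushforward (@completed_lebesgue_measure R)
  ((fun y => x - y) : lebesgueTypeR R -> measurableTypeR R)))
  => // _ [[a b] _ <-] /=.
rewrite /pushforward.
have -> : (fun y => x - y) @^-1` `]a, b] = `[x - b, x - a[%classic.
  apply/seteqP; split => y /=; rewrite !in_itv/= => /andP[h1 h2];
    by apply/andP; split; lra.
rewrite -[RHS]/(lebesgue_measure (_ : set R)).
rewrite !lebesgue_measure_itv/= !lte_fin ltrD2l ltrN2.
by case: ifPn => // _; rewrite -!EFinB; congr EFin; ring.
Qed.

(** Completeness of the measure supplies the measurability of g. *)
Lemma ae_eq_integrable_complete (d : measure_display) (T : measurableType d)
    (R : realType) (mu : {measure set T -> \bar R}) (f g : T -> \bar R) :
  measure_is_complete mu -> ae_eq mu setT f g -> mu.-integrable setT f ->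
  mu.-integrable setT g /\ (\int[mu]_x g x = \int[mu]_x f x)%E.
Proof.
move=> cmu fg intf; have mf := measurable_int _ intf.
have mg : measurable_fun setT g := ae_measurable_fun cmu fg mf.
split; last exact/esym/ae_eq_integral.
apply/integrableP; split => //.
have [_] := integrableP _ _ _ intf; apply: le_lt_trans.
rewrite le_eqVlt; apply/orP; left; apply/eqP/ae_eq_integral => //.
- exact: measurableT_comp.
- exact: measurableT_comp.
- exact/ae_eq_abse/ae_eq_sym.
Qed.

(** The substitution z = x - y, from the completed measure to the Borel one. It
is stated for a Borel version f of the integrand g, since g itself need not be
Borel measurable. *)
Lemma completed_integral_reflect (R : realType) (x : R) (f g : R -> R)
    (Z : set (measurableTypeR R)) :
  (@lebesgue_measure R).-integrable setT (EFin \o f) ->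
  measurable Z -> @lebesgue_measure R Z = 0%E -> (forall s, ~ Z s -> f s = g s) ->
  let gx : lebesgueTypeR R -> R := fun y => g (x - y) in
  (@completed_lebesgue_measure R).-integrable setT (EFin \o gx) /\
  (\int[@completed_lebesgue_measure R]_y gx y = \int[@lebesgue_measure R]_z f z)%R.
Proof.
move=> intf mZ Z0 fg gx.
pose phi : lebesgueTypeR R -> measurableTypeR R := fun y => x - y.
have mphi : measurable_fun setT phi := @measurable_reflect R x.
have mf := measurable_int _ intf.
have push (h : measurableTypeR R -> \bar R) :
    (\int[pushforward (@completed_lebesgue_measure R) phi]_y h y =
     \int[@lebesgue_measure R]_y h y)%E.
  by apply: eq_measure_integral => A mA _; exact: completed_reflect.
have intfx : (@completed_lebesgue_measure R).-integrable setT (EFin \o f \o phi).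
  apply/integrableP; split; first exact: measurableT_comp.
  have [_] := integrableP _ _ _ intf; rewrite -push.
  by rewrite ge0_integral_pushforward//; exact: measurableT_comp.
have ae : ae_eq (@completed_lebesgue_measure R) setT (EFin \o f \o phi) (EFin \o gx).
  exists (phi @^-1` Z); split.
  - by rewrite -[X in measurable X]setTI; exact: mphi.
  - exact: etrans (completed_reflect x mZ) Z0.
  - move=> y /= /not_implyP[_] H; apply: contrapT => nZ; apply: H.
    by rewrite /gx -fg.
have [intg gE] := ae_eq_integrable_complete
  (@completed_lebesgue_measure_is_complete R) ae intfx.
split; first exact: intg.
have := integral_pushforward mphi mf (D := setT) intfx measurableT.
by rewrite push preimage_setT /Rintegral gE => ->.
Qed.

(** * Convolution with a bounded kernel of short range *)

Lemma continuous_pos_part (R : realType) (v : R -> R) :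
  continuous v -> continuous (fun s => pos_part (v s)).
Proof.
by move=> cv s; apply: continuous_max; [exact: cv|exact: cst_continuous].
Qed.

Lemma pos_part_lipschitz (R : realType) (a b : R) :
  `|pos_part a - pos_part b| <= `|a - b|.
Proof.
rewrite /pos_part /Num.max.
case: ltP => a0; case: ltP => b0.
- by rewrite subrr normr0.
- by rewrite sub0r normrN ger0_norm// ler0_norm; lra.
- by rewrite subr0 !ger0_norm; lra.
- by [].
Qed.

Lemma continuous_bounded_itv (R : realType) (h : R -> R) (a b : R) :
  continuous h -> exists2 M, 0 <= M & forall y, a <= y <= b -> `|h y| <= M.
Proof.
move=> ch.
have : compact (h @` `[a, b]).
  by apply: continuous_compact; [exact: continuous_subspaceT|exact: segment_compact].
move=> /compact_bounded[M [_ Mb]]; exists (`|M| + 1); first by rewrite addr_ge0.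
move=> y yab; apply: Mb; first by rewrite ltr_pwDr// ler_norm.
by exists y => //=; rewrite in_itv.
Qed.

Definition bounded_kernel (R : realType) (L r : R) (K : R -> R) : Prop :=
  [/\ 0 < r, measurable_fun [set: measurableTypeR R] K, forall s, 0 <= K s &
      forall s, K s <= L * \1_(`]- r, r[) s].

(** The kernel is left unshifted, so that s enters through h alone. *)
Definition conv (R : realType) (K h : R -> R) (s : R) : R :=
  (\int[@lebesgue_measure R]_z (h (s - z) * K z))%R.

Lemma integrable_scaled_indic (R : realType) (r B : R) :
  (@lebesgue_measure R).-integrable setT (EFin \o (fun z => B * \1_(`]- r, r[) z)).
Proof.
exact: (integrableZl measurableT B (integrable_indic_itv (- r) r false true)).
Qed.

(** Only the values of h on [s - r, s + r] are seen by the kernel. *)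
Lemma conv_integrand_le (R : realType) (L r : R) (K h : R -> R) (s B z : R) :
  bounded_kernel L r K ->
  (forall y, s - r <= y <= s + r -> `|h y| <= B) ->
  `|h (s - z) * K z| <= B * L * \1_(`]- r, r[) z.
Proof.
move=> [r0 _ K0 KL] hB; have := KL z.
rewrite normrM (ger0_norm (K0 z)) indicE mem_setE in_itv/=.
case: (boolP (- r < z < r)) => [/andP[z1 z2]|_]; rewrite !(mulr1, mulr0) => Kz.
  by apply: ler_pM => //; apply: hB; apply/andP; split; lra.
by rewrite (_ : K z = 0) ?mulr0//; apply/eqP; rewrite eq_le Kz K0.
Qed.

Lemma conv_integrable (R : realType) (L r : R) (K h : R -> R) (s : R) :
  bounded_kernel L r K -> continuous h ->
  (@lebesgue_measure R).-integrable setT (EFin \o (fun z => h (s - z) * K z)).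
Proof.
move=> bK ch; have [B B0 hB] := continuous_bounded_itv (s - r) (s + r) ch.
have [_ mK _ _] := bK.
apply: (le_integrable _ _ _ (integrable_scaled_indic r (B * L))) => //.
  apply/measurable_EFinP; apply: measurable_funM => //.
  apply: measurableT_comp; first exact: continuous_measurable_fun.
  exact: measurable_funB.
move=> z _ /=; rewrite lee_fin; apply: (le_trans (conv_integrand_le _ bK hB)).
exact: ler_norm.
Qed.

Lemma conv_dist_le (R : realType) (L r : R) (K h1 h2 : R -> R) (s B : R) :
  bounded_kernel L r K -> continuous h1 -> continuous h2 ->
  (forall y, s - r <= y <= s + r -> `|h1 y - h2 y| <= B) ->
  `|conv K h1 s - conv K h2 s| <= 2 * r * L * B.
Proof.
move=> bK c1 c2 hB; have [r0 _ _ _] := bK.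
rewrite /conv -RintegralB//; try exact: conv_integrable bK _.
under eq_Rintegral do rewrite -mulrBl.
have ch : continuous (fun y => h1 y - h2 y).
  by move=> y; apply: cvgB; [exact: c1|exact: c2].
have ih := conv_integrable s bK ch.
apply: (le_trans (le_normr_Rintegral measurableT ih)).
apply: (@le_trans _ _ (\int[@lebesgue_measure R]_z (B * L * \1_(`]- r, r[) z))%R).
  apply: le_Rintegral => //.
  - exact: (integrable_norm ih).
  - exact: integrable_scaled_indic.
  - by move=> z _; exact: (conv_integrand_le (h := fun y => h1 y - h2 y)).
rewrite RintegralZl//; last exact: integrable_indic_itv.
rewrite /Rintegral integral_indic// setIT.
have muE : @lebesgue_measure R `]- r, r[%classic = (r - - r)%:E.
  apply: etrans (lebesgue_measure_itv _) _.
  by rewrite /= lte_fin ifT//; lra.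
apply: (@le_trans _ _ (B * L * fine (r - - r)%:E)).
  by rewrite le_eqVlt; apply/orP; left; apply/eqP; congr (_ * fine _).
by rewrite /= le_eqVlt; apply/orP; left; apply/eqP; ring.
Qed.

(** For s' within distance 1 of s the integrands are dominated by one multiple
of the indicator of ]- r, r[. *)
Lemma continuous_conv (R : realType) (L r : R) (K h : R -> R) :
  bounded_kernel L r K -> continuous h -> continuous (conv K h).
Proof.
move=> bK ch s.
have [B B0 hB] := continuous_bounded_itv (s - 1 - r) (s + 1 + r) ch.
apply: (@continuity_under_integral R _ _ (@lebesgue_measure R)
  (fun x z => h (x - z) * K z) setT
  measurableT (s - 1) (s + 1) _ _ _ (integrable_scaled_indic r (B * L))).
- by move=> x _; exact: conv_integrable bK _.
- apply: aeW => z _ x _; apply: cvgM; last exact: cvg_cst.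
  by apply: continuous_comp; [apply: cvgB; [exact: cvg_id|exact: cvg_cst]|exact: ch].
- move=> x; rewrite /= in_itv/= => /andP[x1 x2].
  apply: aeW => z _; apply: (conv_integrand_le _ bK) => y /andP[y1 y2].
  by apply: hB; apply/andP; split; lra.
- by rewrite inE/= in_itv/=; apply/andP; split; lra.
Qed.

(** * Travelling waves *)

Lemma is_derive1E (R : realType) (F f : R -> R) :
  (forall s, is_derive s (1:R) F (f s)) -> derive1 F = f.
Proof. by move=> dF; apply/funext => s; rewrite derive1E derive_val. Qed.

Lemma is_derive_derivable (R : realType) (F f : R -> R) :
  (forall s, is_derive s (1:R) F (f s)) -> forall s, derivable F s 1.
Proof. by move=> dF s; case: (dF s). Qed.

Lemma continuous_travelling (R : realType) (F : R -> R) (omega : R) :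
  continuous F -> continuous (fun p : R * R => F (p.1 + omega * p.2)).
Proof.
move=> cF p; apply: continuous_comp; last exact: cF.
apply: cvgD; first exact: cvg_fst.
by apply: cvgM; [exact: cvg_cst|exact: cvg_snd].
Qed.

Lemma travelling_C21 (R : realType) (v w a : R -> R) (omega Theta : R) :
  (forall s, is_derive s (1:R) v (w s)) ->
  (forall s, is_derive s (1:R) w (a s)) -> continuous a ->
  let u x t := v (x + omega * t) + Theta in
  [/\ C21 u, forall x t, dt u x t = omega * w (x + omega * t) &
      forall x t, dxx u x t = a (x + omega * t)].
Proof.
move=> dv dw ca u.
have cv := is_derive_continuous dv; have cw := is_derive_continuous dw.
have d_t x s : is_derive s (1:R) (u x) (omega * w (x + omega * s)).
  have H : is_derive s (1:R) (cst x + omega \*: id) omega.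
    by apply: is_derive_eq; rewrite add0r /GRing.scale/= mulr1.
  have := is_deriveD
    (@is_derive1_comp R v (cst x + omega \*: id) s _ _ (dv _) H)
    (is_derive_cst Theta s 1).
  by rewrite addr0 mulrC.
have shift (F f : R -> R) t s : (forall y, is_derive y (1:R) F (f y)) ->
    is_derive s (1:R) (fun x : R => F (x + omega * t)) (f (s + omega * t)).
  move=> dF.
  have H : is_derive s (1:R) (id + cst (omega * t)) 1.
    by apply: is_derive_eq; rewrite addr0.
  have := @is_derive1_comp R F (id + cst (omega * t)) s _ _ (dF _) H.
    by rewrite mulr1.
have d_x t s : is_derive s (1:R) (u^~ t) (w (s + omega * t)).
  have := is_deriveD (shift v w t s dv) (is_derive_cst Theta s 1).
  by rewrite addr0.
have dxE t : derive1 (u^~ t) = fun x => w (x + omega * t).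
  exact: is_derive1E (d_x t).
have d_xx t s : is_derive s (1:R) (derive1 (u^~ t)) (a (s + omega * t)).
  by rewrite dxE; exact: shift.
have dtE x t : dt u x t = omega * w (x + omega * t).
  by rewrite /dt (is_derive1E (d_t x)).
have dxxE x t : dxx u x t = a (x + omega * t).
  by rewrite /dxx -[derive1n 2 _]/(derive1 (derive1 (u^~ t))) (is_derive1E (d_xx t)).
split => //; split.
- by move=> x; exact: is_derive_derivable (d_t x).
- by move=> x t; exact: is_derive_derivable (d_x t) x.
- by move=> x t; exact: is_derive_derivable (d_xx t) x.
- split.
  + move=> p; apply: cvgD; last exact: cvg_cst.
    exact: continuous_travelling.
  + rewrite (_ : (fun p => _) = fun p : R * R => omega * w (p.1 + omega * p.2)).
      by move=> p; apply: cvgM; [exact: cvg_cst|exact: continuous_travelling].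
    by apply/funext => p; rewrite dtE.
  + rewrite (_ : (fun p => _) = fun p : R * R => w (p.1 + omega * p.2)).
      exact: continuous_travelling.
    by apply/funext => p; rewrite /dx dxE.
  + rewrite (_ : (fun p => _) = fun p : R * R => a (p.1 + omega * p.2)).
      exact: continuous_travelling.
    by apply/funext => p; rewrite dxxE.
Qed.

(** The positive part is 1-Lipschitz and |y| <= |s| + 1 on the range of the
kernel, so N contracts by 2 r L e^{l+1} / c, which is at most 1/2. *)
Lemma profile_exists (R : realType) (c L omega kappa r : R) (K : R -> R) :
  0 < c -> 0 < L -> 0 < omega -> r < 1 ->
  r < c / (4 * L * expR (omega / c + 1)) -> bounded_kernel L r K ->
  exists v w : R -> R, [/\ v 0 = 0, w 0 = kappa,
    forall s, is_derive s (1:R) v (w s) &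
    forall s, is_derive s (1:R) w
      (omega / c * w s + - c^-1 * conv K (fun y => pos_part (v y)) s)].
Proof.
move=> c0 L0 o0 r1 rR bK; have [r0 _ _ _] := bK.
have l0 : 0 <= omega / c by rewrite divr_ge0// ltW.
apply: (@picard_fixpoint R
  (fun v s => - c^-1 * conv K (fun y => pos_part (v y)) s)) => //.
- move=> v cv s; apply: cvgM; first exact: cvg_cst.
  exact: (continuous_conv bK (continuous_pos_part cv)).
- apply/funext => s; rewrite /conv (@eq_Rintegral _ _ _ _ _ (cst 0)).
    by rewrite Rintegral_cst// !mul0r mulr0.
  by move=> z _; rewrite /pos_part maxxx mul0r.
- move=> v1 v2 A c1 c2 A0 vA s; set mu := omega / c + 1 in rR vA *.
  have mu0 : 0 <= mu by rewrite /mu; lra.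
  have := conv_dist_le bK (continuous_pos_part c1) (continuous_pos_part c2)
    (s := s) (B := A * (expR (mu * `|s|) * expR mu)).
  move=> H; rewrite -mulrBr normrM normrN (@gtr0_norm _ c^-1) ?invr_gt0//.
  rewrite [leLHS]mulrC ler_pdivrMr//; apply: (le_trans (H _)).
    move=> y /andP[y1 y2]; apply: (le_trans (pos_part_lipschitz _ _)).
    apply: (le_trans (vA y)); rewrite ler_wpM2l// -expRD ler_expR.
    rewrite -[X in _ <= _ + X]mulr1 -mulrDr ler_wpM2l//.
    have := ler_norm s; have := ler_norm (- s).
    by rewrite ler_norml normrN; lra.
  have e0 := expR_gt0 mu.
  have h : r * (4 * L * expR mu) <= c.
    by apply: ltW; rewrite -ltr_pdivlMr// !mulr_gt0.
  have -> : 2 * r * L * (A * (expR (mu * `|s|) * expR mu)) =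
    A / 2 * expR (mu * `|s|) * (r * (4 * L * expR mu)) by field.
  by rewrite ler_wpM2l// !mulr_ge0// expR_ge0.
Qed.

Theorem theorem2p7 (R : realType) (c Lambda omega : R)
    (c_gt0 : 0 < c) (Lambda_gt0 : 0 < Lambda) (omega_gt0 : 0 < omega) :
  exists Rstar : R, 0 < Rstar /\
    forall (kappa Theta : R), 0 < kappa ->
    forall (r : R) (K : R -> R),
      0 < r -> r < Rstar ->
      lebesgue_measurable_fun K ->
      (forall s : R, 0 <= K s) ->
      (forall s : R, K s <= Lambda * \1_(`]- r, r[) s) ->
      exists u : R -> R -> R, classical_solution c Theta K u /\
        exists v : R -> R,
          [/\ C2 v, v 0 = 0, derive1 v 0 = kappa
            & forall x t : R, u x t = v (x + omega * t) + Theta].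
Proof.
exists (Num.min 1 (c / (4 * Lambda * expR (omega / c + 1)))); split.
  by rewrite lt_min ltr01 divr_gt0// !mulr_gt0// expR_gt0.
move=> kappa Theta _ r K r0; rewrite lt_min => /andP[r1 rR] mK K0 KL.
have [K' [Z [mK' mZ Z0 K'K K'le]]] := borel_version mK K0.
have bK : bounded_kernel Lambda r K'.
  split => // s; first by case/andP: (K'le s).
  by apply: le_trans (KL s); case/andP: (K'le s).
have [v [w [v0 w0 dv dw]]] :=
  profile_exists kappa c_gt0 Lambda_gt0 omega_gt0 r1 rR bK.
have cv := is_derive_continuous dv; have cw := is_derive_continuous dw.
have cpv := continuous_pos_part cv.
have ca : continuous (fun s => omega / c * w s +
    - c^-1 * conv K' (fun y => pos_part (v y)) s).
  move=> s; apply: cvgD; apply: cvgM; try exact: cvg_cst; first exact: cw.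
  exact: (continuous_conv bK cpv).
have [uC21 dtE dxxE] := travelling_C21 omega Theta dv dw ca.
exists (fun x t => v (x + omega * t) + Theta); split; last first.
  exists v; split => //.
  - split.
    + exact: is_derive_derivable dv.
    + by rewrite (is_derive1E dv); exact: is_derive_derivable dw.
    + rewrite -[derive1n 2 v]/(derive1 (derive1 v)).
      by rewrite (is_derive1E dv) (is_derive1E dw).
  - by rewrite (is_derive1E dv).
(* With z = x - y the integrand (u(y, t) - Theta)_+ K(x - y) becomes a
   convolution integrand at the point x + omega t. *)
have main x t := completed_integral_reflect x
  (f := fun z => pos_part (v (x + omega * t - z)) * K' z)
  (g := fun z => pos_part (v (x + omega * t - z)) * K z)
  (conv_integrable (x + omega * t) bK cpv) mZ Z0
  (fun s nZ => congr1 (fun k => _ * k) (K'K s nZ)).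
have interE x t : interaction K Theta (fun x t => v (x + omega * t) + Theta) x t =
    fun y : lebesgueTypeR R => pos_part (v (x + omega * t - (x - y))) * K (x - y).
  apply/funext => y; rewrite /interaction addrK; congr (pos_part (v _) * _); ring.
split => // x t.
- by rewrite interE; exact: (main x t).1.
- rewrite interE (main x t).2 dtE dxxE /conv.
  by field; rewrite gt_eqF.
Qed.
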